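(* Let $p$ be an odd prime and let $q\in\mathbb{C}_p$ with $|q-1|_p<1$ and $\log q\neq 0$. Let $f\in UD(\mathbb{Z}_p)$, let $n\in\mathbb{N}$ ($n\ge 1$), and let $f_n(x)=f(x+n)$. Then $$q^n I_q(f_n)-I_q(f)=\frac{q-1}{\log q}\left(\sum_{i=0}^{n-1}f'(i)\,q^i+\log q\sum_{i=0}^{n-1}f(i)\,q^i\right).$$
   Context: $\mathbb{C}_p$ is the completion of the algebraic closure of $\mathbb{Q}_p$, with absolute value normalized by $|p|_p=1/p$, and $\log$ is the $p$-adic logarithm. $UD(\mathbb{Z}_p)$ is the set of functions $f:\mathbb{Z}_p\to\mathbb{C}_p$ that are uniformly differentiable at every point $a\in\mathbb{Z}_p$, meaning that the difference quotient $F_f(x,y)=\frac{f(x)-f(y)}{x-y}$ (for $x\ne y$) has a limit, denoted $f'(a)$, as $(x,y)\to(a,a)$. For an integer $x\geq 0$, $[x]_q=\frac{1-q^x}{1-q}$. The $p$-adic $q$-integral of $f$ is $$I_q(f)=\int_{\mathbb{Z}_p}f(x)\,d\mu_q(x)=\lim_{N\to\infty}\frac{1}{[p^N]_q}\sum_{x=0}^{p^N-1}f(x)\,q^x .$$ *)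

(* Defs.v *)
From HB Require Import structures.
From mathcomp Require Import all_boot all_order all_algebra.
From mathcomp Require Import all_classical all_reals topology.

Set Implicit Arguments.
Unset Strict Implicit.
Unset Printing Implicit Defensive.

Import Order.TTheory GRing.Theory Num.Theory.

Local Open Scope classical_set_scope.
Local Open Scope ring_scope.

(* A normedZmodType would force `|x *+ n| = `|x| *+ n, which no
   non-archimedean absolute value satisfies; hence the separate field absv,
   tied to the library topology through ballE_absv. *)
HB.mixin Record isUltrametric (R : realType) K
    of GRing.Field K & CompletePseudoMetric R K := {
  absv : K -> R;
  absv_ge0 : forall x, 0 <= absv x;
  absv_eq0 : forall x, absv x = 0 <-> x = 0;
  absvM : {morph absv : x y / x * y};
  absvD : forall x y, absv (x + y) <= Num.max (absv x) (absv y);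
  ballE_absv : forall (x : K) (e : R), ball x e = [set y | absv (x - y) < e]
}.

#[short(type="completeUltrametricFieldType")]
HB.structure Definition CompleteUltrametricField (R : realType) :=
  {K of isUltrametric R K & GRing.Field K & CompletePseudoMetric R K}.

Section Subfields.
Context {R : realType} {K : completeUltrametricFieldType R}.

(* If moreover |p| = 1/p for a prime p, then the absolute value induced on the
   rationals is the p-adic one, so their closure in the complete field K is a
   completion of (Q, |.|_p), that is, Q_p. *)
Definition Qp : set K := closure (range (@ratr K)).

Definition Zp : set K := [set x | Qp x /\ absv x <= 1].

Definition Qp_alg : set K :=
  [set x | exists P : {poly K},
     [/\ P != 0, (forall i, Qp P`_i) & root P x]].

End Subfields.
Arguments Qp {R} K.
Arguments Zp {R} K.
Arguments Qp_alg {R} K.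

(* C_p, determined up to isometric isomorphism: K is complete and contains
   Q_p; the set Qp_alg K of its elements algebraic over Q_p is an algebraic
   closure of Q_p, and it is dense in K. *)
HB.mixin Record isPadicComplex (p : nat) (R : realType) K
    of CompleteUltrametricField R K := {
  absv_p : absv (p%:R : K) = p%:R^-1 :> R;
  Qp_alg_closed : forall P : {poly K},
    (forall i, Qp_alg K P`_i) -> (1 < size P)%N ->
    exists2 x, Qp_alg K x & root P x;
  Qp_alg_dense : closure (Qp_alg K) = setT
}.

#[short(type="padicComplexType")]
HB.structure Definition PadicComplex (p : nat) (R : realType) :=
  {K of isPadicComplex p R K & CompleteUltrametricField R K}.

Section PadicIntegral.
Context {p : nat} {R : realType} {C : padicComplexType p R}.
Implicit Types (f : C -> C) (q a x : C).

(* The Mercator series, hence only meaningful for |x - 1| < 1. *)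
Definition padic_log x : C :=
  limn (fun N => \sum_(1 <= k < N) (-1) ^+ k.+1 * (x - 1) ^+ k / k%:R).

Definition diff_quot f (z : C * C) : C := (f z.1 - f z.2) / (z.1 - z.2).

Definition nbhs_offdiag a : set_system (C * C) :=
  within [set z | [/\ Zp C z.1, Zp C z.2 & z.1 != z.2]] (nbhs (a, a)).

(* A function Z_p -> C_p is represented by any of its extensions C -> C: all
   notions below depend only on the values of f on Z_p. *)
Definition UD : set (C -> C) :=
  [set f | forall a, Zp C a -> cvg (diff_quot f @ nbhs_offdiag a)].

Definition padic_deriv f a : C := lim (diff_quot f @ nbhs_offdiag a).

Definition qnum q (m : nat) : C := (1 - q ^+ m) / (1 - q).

Definition q_sum q f (N : nat) : C :=
  (qnum q (p ^ N))^-1 * \sum_(0 <= x < p ^ N) f x%:R * q ^+ x.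

Definition q_integrable q f : Prop := cvgn (q_sum q f).

Definition q_integral q f : C := limn (q_sum q f).

End PadicIntegral.

(* Main.v *)
(** Write P = p^N, Q = q^P and S_N(f) = (1/[P]_q) sum_(x < P) f(x) q^x.

  Binomial expansion gives (Q - 1)/P = sum_k C(P - 1, k - 1) (q - 1)^k / k; since
  C(P - 1, k - 1) tends p-adically to (-1)^(k-1), the left-hand side tends to
  log q, termwise and with a tail bounded by the null sequence |q - 1|^k / |k|.
  As log q <> 0, no Q equals 1, and P/[P]_q tends to (q - 1)/log q.

  By compactness, f satisfies a uniform estimate: the difference quotients at
  pairs of naturals in a common class modulo p^M are within e of one another.
  Splitting [0, p^(N+1)) into p translates of [0, P) then yields
  |S_(N+1) - S_N| <= K max(e, |sum_(x < P) q^x g(x mod p^M)|) for some g that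
  does not depend on N, and that last sum is a constant multiple of Q - 1 -> 0.
  In an ultrametric complete field this makes S_N convergent.

  Finally q^n S_N(f_n) - S_N(f) telescopes to the sum over i < n of
  (f(P + i) q^(P + i) - f(i) q^i)/[P]_q, whose limit is read off from
  f(P + i) - f(i) ~ P f'(i) and Q - 1 ~ P log q. *)

Require Import Defs.
From mathcomp Require Import all_boot all_order all_algebra.
From mathcomp Require Import all_classical all_reals topology.
From mathcomp Require Import interval_inference normedtype sequences.
From mathcomp Require Import ring zify.

Import Order.TTheory GRing.Theory Num.Theory.
Import numFieldNormedType.Exports.

Local Open Scope classical_set_scope.
Local Open Scope ring_scope.

(** * Ultrametric absolute values and limits of sequences *)

Section Ultrametric.
Context {R : realType} {K : completeUltrametricFieldType R}.
Implicit Types (x y z : K) (u v : nat -> K).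

Lemma absv0 : absv (0 : K) = 0.
Proof. exact/absv_eq0. Qed.

Lemma absv_gt0 x : (0 < absv x) = (x != 0).
Proof.
rewrite lt_neqAle absv_ge0 andbT eq_sym; congr (~~ _).
by apply/eqP/eqP => /absv_eq0.
Qed.

Lemma absv1 : absv (1 : K) = 1.
Proof.
have h : absv (1 : K) != 0 by rewrite gt_eqF// absv_gt0 oner_eq0.
by apply: (mulfI h); rewrite -absvM !mulr1.
Qed.

Lemma absvN x : absv (- x) = absv x.
Proof.
apply/eqP; rewrite -(eqrXn2 (n := 2)) ?absv_ge0// !expr2 -!absvM.
by rewrite mulrNN.
Qed.

Lemma absvBC x y : absv (x - y) = absv (y - x).
Proof. by rewrite -absvN opprB. Qed.

Lemma absvX x n : absv (x ^+ n) = absv x ^+ n.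
Proof. by elim: n => [|n IH]; rewrite ?expr0 ?absv1// !exprS absvM IH. Qed.

Lemma absvV x : absv x^-1 = (absv x)^-1.
Proof.
have [->|x0] := eqVneq x 0; first by rewrite invr0 absv0 invr0.
have h : absv x != 0 by rewrite gt_eqF// absv_gt0.
by apply: (mulfI h); rewrite -absvM !divff// absv1.
Qed.

Lemma absv_sign n : absv ((-1) ^+ n : K) = 1.
Proof. by rewrite absvX absvN absv1 expr1n. Qed.

Lemma absvD_le x y e : absv x <= e -> absv y <= e -> absv (x + y) <= e.
Proof. by move=> xe ye; rewrite (le_trans (absvD _ _))// ge_max xe. Qed.

Lemma absvD_lt x y e : absv x < e -> absv y < e -> absv (x + y) < e.
Proof. by move=> xe ye; rewrite (le_lt_trans (absvD _ _))// gt_max xe. Qed.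

Lemma absvB_trans_le y x z e :
  absv (x - y) <= e -> absv (y - z) <= e -> absv (x - z) <= e.
Proof. by move=> xy yz; rewrite -(subrKA y) absvD_le. Qed.

Lemma absvB_trans_lt y x z e :
  absv (x - y) < e -> absv (y - z) < e -> absv (x - z) < e.
Proof. by move=> xy yz; rewrite -(subrKA y) absvD_lt. Qed.

Lemma absv_sum_le I (r : seq I) (P : pred I) (F : I -> K) e : 0 <= e ->
  (forall i, P i -> absv (F i) <= e) -> absv (\sum_(i <- r | P i) F i) <= e.
Proof.
move=> e0 Fe; elim/big_rec: _ => [|i x Pi xe]; first by rewrite absv0.
by rewrite absvD_le ?Fe.
Qed.

Lemma absv_sum_lt I (r : seq I) (P : pred I) (F : I -> K) e : 0 < e ->
  (forall i, P i -> absv (F i) < e) -> absv (\sum_(i <- r | P i) F i) < e.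
Proof.
move=> e0 Fe; elim/big_rec: _ => [|i x Pi xe]; first by rewrite absv0.
by rewrite absvD_lt ?Fe.
Qed.

Lemma absv_nat_le1 n : absv (n%:R : K) <= 1.
Proof.
elim: n => [|n IH]; first by rewrite absv0.
by rewrite -natr1 absvD_le ?absv1.
Qed.

Lemma cvg_absvP u (l : K) :
  (u @ \oo --> l) <-> forall e : R, 0 < e -> \forall n \near \oo, absv (u n - l) < e.
Proof.
rewrite cvg_ballP; split => ul e e0; apply: filterS (ul e e0) => n.
  by rewrite ballE_absv/= absvBC.
by rewrite ballE_absv/= absvBC.
Qed.

Lemma cvg_absv_lt0 u (l : K) e : u @ \oo --> l -> 0 < e ->
  \forall n \near \oo, absv (u n - l) < e.
Proof. by move/cvg_absvP; exact. Qed.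

(** A point common to the balls of radius |a - b| around a and b would give |a - b| < |a - b|. *)
Lemma hausdorff_ultrametric : hausdorff_space K.
Proof.
rewrite ball_hausdorff => a b ab.
have d0 : 0 < absv (a - b) by rewrite absv_gt0 subr_eq0.
exists (PosNum d0, PosNum d0) => /=; apply/eqP; rewrite -subset0 => x /=.
rewrite !ballE_absv /= => -[ax bx]; have := absvB_trans_lt x a b (absv (a - b)).
by rewrite ltxx ax absvBC bx => /(_ isT isT).
Qed.

Lemma cvgD_absv u v (a b : K) :
  u @ \oo --> a -> v @ \oo --> b -> (fun n => u n + v n) @ \oo --> a + b.
Proof.
move=> ua vb; apply/cvg_absvP => e e0; near=> n.
rewrite opprD addrACA; apply: absvD_lt.
- by near: n; exact: cvg_absv_lt0.
- by near: n; exact: cvg_absv_lt0.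
Unshelve. all: by end_near. Qed.

Lemma cvgM_absv u v (a b : K) :
  u @ \oo --> a -> v @ \oo --> b -> (fun n => u n * v n) @ \oo --> a * b.
Proof.
have M0 (x : K) : 0 < 1 + absv x by rewrite ltr_pwDl ?absv_ge0.
move=> ua vb; apply/cvg_absvP => e e0; near=> n.
have -> : u n * v n - a * b = (u n - a) * (v n - b) + a * (v n - b) + (u n - a) * b.
  by ring.
(* The divisor [1 + absv c] stays positive even when c = 0. *)
have lt (c x : K) : absv x < e / (1 + absv c) -> absv x * absv c < e.
  move=> h; have : absv x * (1 + absv c) < e by rewrite -ltr_pdivlMr ?M0.
  by apply: le_lt_trans; rewrite ler_wpM2l ?absv_ge0// lerDr.
apply: absvD_lt; first apply: absvD_lt.
- rewrite absvM -[e]mul1r ltr_pM ?absv_ge0//.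
    by near: n; exact: cvg_absv_lt0.
  by near: n; exact: cvg_absv_lt0.
- by rewrite absvM mulrC; apply: lt; near: n; apply: cvg_absv_lt0 => //; rewrite divr_gt0 ?M0.
- by rewrite absvM; apply: lt; near: n; apply: cvg_absv_lt0 => //; rewrite divr_gt0 ?M0.
Unshelve. all: by end_near. Qed.

Lemma cvgN_absv u (a : K) : u @ \oo --> a -> (fun n => - u n) @ \oo --> - a.
Proof.
move=> ua; apply/cvg_absvP => e e0; near=> n.
by rewrite -opprD absvN; near: n; exact: cvg_absv_lt0.
Unshelve. all: by end_near. Qed.

Lemma cvg_sum_absv n (u : nat -> nat -> K) (a : nat -> K) :
  (forall i, u i @ \oo --> a i) ->
  (fun N => \sum_(0 <= i < n) u i N) @ \oo --> \sum_(0 <= i < n) a i.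
Proof.
move=> ua; elim: n => [|n IH].
  rewrite big_geq//; under eq_cvg do rewrite big_geq//; exact: cvg_cst.
rewrite big_nat_recr//=; under eq_cvg do rewrite big_nat_recr//=.
exact: cvgD_absv.
Qed.

(** The absolute value is locally constant away from 0: once |u n - a| < |a|, each of u n and a is
    the other plus a term smaller than |a|. *)
Lemma near_absv_eq u (a : K) : u @ \oo --> a -> a != 0 ->
  \forall n \near \oo, absv (u n) = absv a.
Proof.
move=> ua a0; have a0' : 0 < absv a by rewrite absv_gt0.
near=> n.
have h : absv (u n - a) < absv a by near: n; exact: cvg_absv_lt0.
apply/eqP; rewrite eq_le -{1}(subrK a (u n)) absvD_le ?(ltW h)//=.
rewrite leNgt; apply/negP => una.
have : absv (a - u n + u n) < absv a by rewrite absvD_lt// absvBC.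
by rewrite subrK ltxx.
Unshelve. all: by end_near. Qed.

Lemma cvgV_absv u (a : K) : u @ \oo --> a -> a != 0 ->
  (fun n => (u n)^-1) @ \oo --> a^-1.
Proof.
move=> ua a0; have a0' : 0 < absv a by rewrite absv_gt0.
apply/cvg_absvP => e e0; near=> n.
have ea : absv (u n) = absv a by near: n; exact: near_absv_eq.
have un0 : u n != 0 by rewrite -absv_gt0 ea.
have -> : (u n)^-1 - a^-1 = (a - u n) * ((u n)^-1 * a^-1).
  by field; rewrite a0.
rewrite absvM absvBC absvM !absvV ea -invfM ltr_pdivrMr ?mulr_gt0//.
near: n; apply: cvg_absv_lt0 => //; by rewrite !mulr_gt0.
Unshelve. all: by end_near. Qed.

(** By the strong triangle inequality, |u n - u N| is at most the largest of the consecutive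
    differences, so small steps already make a Cauchy sequence. *)
Lemma cvgn_ultrametric u :
  (forall e, 0 < e -> \forall n \near \oo, absv (u n.+1 - u n) < e) ->
  cvgn u.
Proof.
move=> du; apply/cauchy_cvgP/cauchyP => e e0.
have [N _ dN] := du e e0; exists (u N); exists N => // n /= Nn.
rewrite ballE_absv/= absvBC -(subnK Nn) addnC.
elim: (n - N)%N => [|k IH]; first by rewrite addn0 subrr absv0.
by apply: (absvB_trans_lt (u (N + k)%N)); rewrite // addnS; apply: dN; exact: leq_addr.
Qed.

End Ultrametric.

(** * A real null sequence that bounds the Mercator terms *)

Lemma cvg_natmul_expr {R : realType} (r : R) : 0 <= r < 1 ->
  (fun k => k%:R * r ^+ k) @ \oo --> (0 : R).
Proof.
(* With s = sqrt r, k s^k (1 - s) <= 1 - s^k, so k r^k <= s^k / (1 - s). *)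
move=> /andP[r0 r1]; set s := Num.sqrt r.
have s0 : 0 <= s by rewrite sqrtr_ge0.
have sr : s ^+ 2 = r by rewrite sqr_sqrtr.
have s1 : s < 1 by rewrite -(ltr_pXn2r (n := 2)) ?nnegrE// sr expr1n.
have s1' : 0 < 1 - s by rewrite subr_gt0.
have sk0 k : 0 <= s ^+ k by rewrite exprn_ge0.
have bd k : k%:R * s ^+ k * (1 - s) <= 1 - s ^+ k.
  elim: k => [|k IH]; first by rewrite !mul0r subrr.
  have h : s * (k%:R * s ^+ k * (1 - s)) <= s * (1 - s ^+ k) by rewrite ler_wpM2l.
  have h2 : s * s ^+ k * (1 - s) <= 1 - s.
    by rewrite ler_piMl ?(ltW s1')// -exprS exprn_ile1// ltW.
  rewrite exprS -natr1; apply: (le_trans (y := s * (1 - s ^+ k) + (1 - s))).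
    by apply: le_trans (lerD h h2); rewrite le_eqVlt; apply/orP; left; apply/eqP; ring.
  by rewrite le_eqVlt; apply/orP; left; apply/eqP; ring.
apply/cvgrPdist_lt => e e0.
have es0 : 0 < e * (1 - s) by rewrite mulr_gt0.
have sn : `|s| < 1 by rewrite ger0_norm.
have /cvgrPdist_lt/(_ _ es0) := cvg_expr sn.
apply: filterS => k; rewrite !sub0r !normrN !ger0_norm ?mulr_ge0 ?exprn_ge0// => sk.
rewrite -(ltr_pM2r s1'); apply: le_lt_trans sk.
rewrite -sr -exprM mulnC exprM expr2.
have -> : k%:R * (s ^+ k * s ^+ k) * (1 - s) = k%:R * s ^+ k * (1 - s) * s ^+ k by ring.
rewrite -[leRHS]mul1r ler_wpM2r//.
by apply: (le_trans (bd k)); rewrite gerBl.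
Qed.

(** * The p-adic size of natural numbers *)

Section PadicNat.
Context {p : nat} {R : realType} {C : padicComplexType p R}.
Hypothesis p_prime : prime p.

Lemma absv_natXp N : absv ((p ^ N)%:R : C) = p%:R^-1 ^+ N.
Proof. by rewrite natrX absvX absv_p. Qed.

Lemma absv_natp_lt1 : absv (p%:R : C) < 1.
Proof. by rewrite absv_p invf_lt1 ?ltr1n ?ltr0n ?prime_gt1 ?prime_gt0. Qed.

(** If |m| < 1, a Bezout relation u p = v m + 1 writes 1 as a difference of two elements of absolute
    value below 1. *)
Lemma absv_nat_coprime m : coprime p m -> absv (m%:R : C) = 1.
Proof.
move=> cpm; apply/eqP; rewrite eq_le absv_nat_le1 leNgt; apply/negP => m1.
have [u [v uv]] : exists u v, (u * p = v * m + 1)%N.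
  have [u v /= e _] := egcdnP m (prime_gt0 p_prime).
  by exists u, v; rewrite e; move/eqP: cpm => ->.
have : absv ((u * p)%:R - (v * m)%:R : C) < 1.
  have le1 k j : absv (j%:R : C) < 1 -> absv ((k * j)%:R : C) < 1.
    move=> h; rewrite natrM absvM; apply: le_lt_trans h.
    by rewrite ler_piMl ?absv_ge0// absv_nat_le1.
  by apply: absvD_lt; rewrite ?absvN le1// absv_natp_lt1.
by rewrite uv natrD addrAC subrr add0r absv1 ltxx.
Qed.

(** Each factor p of k divides |k| by p, and the cofactor prime to p has absolute value 1. The bound
    controls the denominators of the logarithm and yields characteristic 0. *)
Lemma absv_nat_ge k : (0 < k)%N -> k%:R^-1 <= absv (k%:R : C).
Proof.
elim/ltn_ind: k => k IH k0.
have [/dvdnP[j kj]|pk] := boolP (p %| k)%N; last first.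
  by rewrite absv_nat_coprime ?prime_coprime// invf_le1 ?ler1n ?ltr0n.
have j0 : (0 < j)%N by move: k0; rewrite kj muln_gt0 => /andP[].
rewrite kj !natrM absvM absv_p invfM ler_wpM2r ?invr_ge0// IH//.
by rewrite kj -[ltnLHS]muln1 ltn_pmul2l// prime_gt1.
Qed.

Lemma padic_natr_eq0 k : (k%:R == 0 :> C) = (k == 0)%N.
Proof.
case: k => [|k]; first by rewrite mulr0n !eqxx.
apply/negbTE; rewrite -absv_gt0 (lt_le_trans _ (absv_nat_ge _ (ltn0Sn k)))// invr_gt0.
Qed.

Lemma cvg_natXp : (fun N => (p ^ N)%:R : C) @ \oo --> (0 : C).
Proof.
apply/cvg_absvP => e e0.
have h : `|(p%:R^-1 : R)| < 1 by rewrite ger0_norm ?invr_ge0// -(absv_p (s := C)) absv_natp_lt1.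
have /cvgrPdist_lt/(_ _ e0) := cvg_expr h; apply: filterS => N.
by rewrite sub0r normrN ger0_norm ?exprn_ge0 ?invr_ge0// subr0 absv_natXp.
Qed.

Lemma absv_nat_eqmod i j m : i = j %[mod p ^ m] ->
  absv (i%:R - j%:R : C) <= absv ((p ^ m)%:R : C).
Proof.
wlog : i j / (j <= i)%N => [h ij|ji /eqP].
  by case/orP: (leq_total i j) => ?; [rewrite absvBC|]; apply: h.
rewrite eqn_mod_dvd// => /dvdnP[k ij].
by rewrite -natrB// ij natrM absvM ler_piMl ?absv_ge0// absv_nat_le1.
Qed.

Lemma natr_in_Zp i : Defs.Zp C i%:R.
Proof.
split; last exact: absv_nat_le1.
by apply: subset_closure; exists i%:R; rewrite ?ratr_nat.
Qed.
End PadicNat.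

(** * The logarithm as a limit of difference quotients *)

Section PadicLog.
Context {p : nat} {R : realType} {C : padicComplexType p R}.
Hypothesis p_prime : prime p.
Implicit Types q : C.

(** The difference quotient of x -> q^x at 0 with step p^N. *)
Definition log_quot q N : C := (q ^+ (p ^ N) - 1) / (p ^ N)%:R.

Lemma pX_neq0 N : (p ^ N)%:R != 0 :> C.
Proof. by rewrite padic_natr_eq0// -lt0n expn_gt0 prime_gt0. Qed.

(** The identity P C(P - 1, k - 1) = k C(P, k) trades the division by P for one by k. Binomials
    beyond P vanish, so B is free and the sum can be matched with a longer partial sum of the
    logarithm. *)
Lemma log_quotE q N B : (p ^ N < B)%N ->
  log_quot q N =
    \sum_(1 <= k < B) 'C((p ^ N).-1, k.-1)%:R * ((q - 1) ^+ k / k%:R).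
Proof.
move=> NB; have P0 : (0 < p ^ N)%N by rewrite expn_gt0 prime_gt0.
rewrite /log_quot (big_cat_nat (n := (p ^ N).+1))//= [X in _ = _ + X]big_nat_cond.
rewrite [X in _ = _ + X]big1 ?addr0; last first.
  move=> k; rewrite andbT => /andP[Pk _]; rewrite bin_small ?mul0r//.
  by case: k Pk => //= k; lia.
have -> : q ^+ (p ^ N) = (q - 1 + 1) ^+ (p ^ N) by rewrite subrK.
rewrite exprD1n -(big_mkord xpredT (fun i => (q - 1) ^+ i *+ 'C(p ^ N, i))).
rewrite big_nat_recl//= bin0 expr0 addrAC subrr add0r.
rewrite big_add1/= big_distrl/=; apply: eq_bigr => k _.
have := pX_neq0 N; set P := (p ^ N)%N => Pn0.
have := congr1 (fun m => m%:R : C) (mul_bin_diag P k).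
have k0 : k.+1%:R != 0 :> C by rewrite padic_natr_eq0.
rewrite !natrM -mulr_natr => h.
apply: (mulfI (mulf_neq0 Pn0 k0)).
transitivity (k.+1%:R * 'C(P, k.+1)%:R * (q - 1) ^+ k.+1).
  by field; rewrite Pn0.
by rewrite -h; field; rewrite addrC natr1.
Qed.

(** Pascal's rule gives C(P - 1, k + 1) = P C(P - 1, k) / (k + 1) - C(P - 1, k), whose first term
    tends to 0 with P. *)
Lemma cvg_bin_pX k :
  (fun N => 'C((p ^ N).-1, k)%:R : C) @ \oo --> ((-1) ^+ k : C).
Proof.
elim: k => [|k IH].
  by under eq_cvg do rewrite bin0; exact: cvg_cst.
have k0 : k.+1%:R != 0 :> C by rewrite padic_natr_eq0.
have -> : (fun N => 'C((p ^ N).-1, k.+1)%:R : C) =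
    (fun N => (p ^ N)%:R * 'C((p ^ N).-1, k)%:R / k.+1%:R - 'C((p ^ N).-1, k)%:R).
  apply/funext => N; have P0 : (0 < p ^ N)%N by rewrite expn_gt0 prime_gt0.
  rewrite -natrM mul_bin_diag natrM mulrAC divff// mul1r.
  by rewrite -{2}(prednK P0) binS natrD addrK.
have -> : (-1) ^+ k.+1 = 0 * (-1) ^+ k / k.+1%:R - (-1) ^+ k :> C.
  by rewrite exprS mulN1r !mul0r sub0r.
apply: cvgD_absv (cvgN_absv _ _ IH); apply: cvgM_absv (cvg_cst _).
by apply: cvgM_absv IH; exact: cvg_natXp.
Qed.

(** Since 1/|k| <= k, the term is at most k |q - 1|^k. *)
Lemma near_mercator_term q e : absv (q - 1) < 1 -> 0 < e ->
  \forall k \near \oo, absv ((q - 1) ^+ k / k%:R) < e.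
Proof.
move=> q1 e0; have h : 0 <= absv (q - 1) < 1 by rewrite absv_ge0.
have /cvgrPdist_lt/(_ _ e0) := cvg_natmul_expr _ h.
move=> he; near=> k.
have k0 : (0 < k)%N by near: k; exact: nbhs_infty_gt.
have : `|0 - k%:R * absv (q - 1) ^+ k| < e by near: k.
rewrite sub0r normrN ger0_norm ?mulr_ge0 ?exprn_ge0 ?absv_ge0//.
apply: le_lt_trans; rewrite absvM absvX absvV mulrC ler_wpM2r ?exprn_ge0 ?absv_ge0//.
have := absv_nat_ge (C := C) p_prime k k0.
rewrite -[X in _ -> _ <= X]invrK; rewrite lef_pV2 ?posrE ?invr_gt0 ?ltr0n//.
by rewrite absv_gt0 padic_natr_eq0// -lt0n.
Unshelve. all: by end_near. Qed.

(** [padic_log] is a [limn], informative only once the series converges; here it is enough that its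
    terms tend to 0. *)
Lemma cvg_padic_log q : absv (q - 1) < 1 ->
  (fun N => \sum_(1 <= k < N) (-1) ^+ k.+1 * (q - 1) ^+ k / k%:R) @ \oo
    --> padic_log q.
Proof.
move=> q1; apply: cvgn_ultrametric => e e0; near=> N.
rewrite big_nat_recr/=; last by near: N; exact: nbhs_infty_ge.
rewrite addrAC subrr add0r -mulrA absvM absv_sign mul1r.
by near: N; exact: near_mercator_term.
Unshelve. all: by end_near. Qed.

Lemma cvg_log_quot q : absv (q - 1) < 1 ->
  log_quot q @ \oo --> padic_log q.
Proof.
move=> q1; apply/cvg_absvP => e e0.
have [K0 _ HK0] := near_mercator_term _ _ q1 e0.
(* Below any fixed K only finitely many terms occur, so one threshold on N serves them all. *)
have head K : \forall N \near \oo, forall k, (0 < k < K)%N ->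
    absv (('C((p ^ N).-1, k.-1)%:R - (-1) ^+ k.+1) * ((q - 1) ^+ k / k%:R)) < e.
  elim: K => [|K IH]; first by near=> N => k; rewrite ltn0 andbF.
  have cK : (fun N => ('C((p ^ N).-1, K.-1)%:R - (-1) ^+ K.-1) *
      ((q - 1) ^+ K / K%:R)) @ \oo --> (0 : C).
    rewrite -[X in _ --> X](mul0r ((q - 1) ^+ K / K%:R)).
    apply: cvgM_absv (cvg_cst _); rewrite -(subrr ((-1) ^+ K.-1)).
    by apply: cvgD_absv (cvg_cst _); exact: cvg_bin_pX.
  near=> N => k /andP[k0]; rewrite ltnS leq_eqVlt => /predU1P[kK|kK]; last first.
    have h : forall k, (0 < k < K)%N -> absv (('C((p ^ N).-1, k.-1)%:R -
       (-1) ^+ k.+1) * ((q - 1) ^+ k / k%:R)) < e by near: N.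
    by rewrite h// k0.
  have -> : (-1) ^+ k.+1 = (-1) ^+ K.-1 :> C.
    by rewrite -kK; case: k {kK} k0 => //= k _; rewrite !exprS !mulN1r opprK.
  by rewrite kK -[X in absv X]subr0; near: N; exact: cvg_absv_lt0.
near=> N.
(* B must exceed p^N to express [log_quot], and be large enough for the partial sum to be within e
   of the logarithm. *)
have [B [NB sB]] : exists B, (p ^ N < B)%N /\
    absv (\sum_(1 <= k < B) (-1) ^+ k.+1 * (q - 1) ^+ k / k%:R - padic_log q) < e.
  have [M _ HM] := cvg_absv_lt0 _ _ _ (cvg_padic_log _ q1) e0.
  exists (maxn M (p ^ N).+1); split; first exact: leq_maxr.
  by apply: HM; exact: leq_maxl.
apply: absvB_trans_lt sB; rewrite (log_quotE _ _ _ NB) -sumrB big_nat_cond.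
apply: absv_sum_lt => // k; rewrite andbT => /andP[k0 kB].
rewrite -mulrA -mulrBl.
have [kK|Kk] := ltnP k K0.
  suff : forall k, (0 < k < K0)%N -> absv (('C((p ^ N).-1, k.-1)%:R -
       (-1) ^+ k.+1) * ((q - 1) ^+ k / k%:R)) < e by apply; rewrite k0.
  by near: N.
(* In the tail the coefficient, a difference of two integers, has absolute value at most 1, so the
   Mercator term alone bounds it. *)
rewrite absvM; apply: le_lt_trans (HK0 _ Kk); rewrite ler_piMl ?absv_ge0//.
by apply: absvD_le; rewrite ?absvN ?absv_sign// absv_nat_le1.
Unshelve. all: by end_near. Qed.

(** If q^(p^N) = 1, every later quotient vanishes, and so does their limit log q. *)
Lemma log_quot_neq0 q N : absv (q - 1) < 1 -> padic_log q != 0 ->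
  log_quot q N != 0.
Proof.
move=> q1; apply: contra_neq => qN.
have {}qN : q ^+ (p ^ N) = 1.
  by move/eqP: qN; rewrite mulf_eq0 invr_eq0 (negPf (pX_neq0 _)) orbF subr_eq0 => /eqP.
apply: (cvg_unique hausdorff_ultrametric (cvg_log_quot _ q1)).
apply/cvg_absvP => e e0; near=> M.
have NM : (N <= M)%N by near: M; exact: nbhs_infty_ge.
by rewrite /log_quot -(subnKC NM) expnD exprM qN expr1n subrr mul0r subr0 absv0.
Unshelve. all: by end_near. Qed.

End PadicLog.

(** * Uniform estimates for difference quotients *)

Section UniformlyDifferentiable.
Context {p : nat} {R : realType} {C : padicComplexType p R}.
Hypothesis p_prime : prime p.
Implicit Types f : C -> C.

Lemma UD_near f a e : UD f -> Defs.Zp C a -> 0 < e ->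
  exists2 d, 0 < d & forall x y, Defs.Zp C x -> Defs.Zp C y -> x != y ->
    absv (a - x) < d -> absv (a - y) < d ->
    absv (diff_quot f (x, y) - padic_deriv f a) < e.
Proof.
move=> /(_ a) fa /fa {}fa e0.
have : nbhs (padic_deriv f a) (ball (padic_deriv f a) e) by exact: nbhsx_ballx.
move=> /fa [] /= [A B] /= [/nbhs_ballP[d1 /= d10 dA] /nbhs_ballP[d2 /= d20 dB]] AB.
exists (Num.min d1 d2); first by rewrite lt_min d10.
move=> x y Zx Zy xy; rewrite !lt_min => /andP[ax _] /andP[_ ay].
have /AB : (A `*` B) (x, y).
  by split; [apply: dA | apply: dB]; rewrite ballE_absv.
by move=> /(_ (And3 Zx Zy xy)) /=; rewrite ballE_absv/= absvBC.
Qed.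

(** Natural arguments suffice, since [q_sum] evaluates its integrand only there. *)
Let nat_dq f (i j : nat) : C := diff_quot f (i%:R, j%:R).

Lemma eqmod_pX_le m n i j : (m <= n)%N -> i = j %[mod p ^ n] ->
  i = j %[mod p ^ m].
Proof.
move=> mn ij; have d := dvdn_exp2l p mn.
by rewrite -(modn_dvdm i d) ij (modn_dvdm j d).
Qed.

(* König's argument: if the estimate fails on a residue class modulo p^m, it
   fails on one of its subclasses modulo p^(m+1); a nested sequence of bad classes
   shrinks to a point of Z_p, where differentiability is violated. *)
Lemma UD_nat_uniform f e : UD f -> 0 < e ->
  exists M, forall i j i' j', i != j -> i' != j' ->
    j = i %[mod p ^ M] -> i' = i %[mod p ^ M] -> j' = i %[mod p ^ M] ->
    absv (nat_dq f i j - nat_dq f i' j') < e.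
Proof.
move=> UDf e0.
(* The estimate on the class of a modulo p^m, at some depth M; [maxn m M] keeps all four points in
   that class. *)
pose good a m := exists M, forall i j i' j', i != j -> i' != j' ->
    i = a %[mod p ^ m] -> j = i %[mod p ^ maxn m M] ->
    i' = i %[mod p ^ maxn m M] -> j' = i %[mod p ^ maxn m M] ->
    absv (nat_dq f i j - nat_dq f i' j') < e.
suff [M HM] : good 0%N 0%N.
  by exists M => i j i' j' ij ij' *; apply: HM; rewrite ?max0n// expn0 !modn1.
apply: contrapT => bad0.
(* The implication stands under the existential so that [choice] yields a function on all pairs. *)
have step (ma : nat * nat) : exists b, ~ good ma.2 ma.1 ->
    b = ma.2 %[mod p ^ ma.1] /\ ~ good b ma.1.+1.
  case: ma => m a /=; apply: contrapT => nob.
  have bad_a : ~ good a m by move=> g; apply: nob; exists 0%N.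
  have allgood b : b = a %[mod p ^ m] -> good b m.+1.
    by move=> ba; apply: contrapT => gb; apply: nob; exists b.
  have ch b : exists M, b = a %[mod p ^ m] -> forall i j i' j',
      i != j -> i' != j' ->
      i = b %[mod p ^ m.+1] -> j = i %[mod p ^ maxn m.+1 M] ->
      i' = i %[mod p ^ maxn m.+1 M] -> j' = i %[mod p ^ maxn m.+1 M] ->
      absv (nat_dq f i j - nat_dq f i' j') < e.
    have [/allgood[M HM]|ba] := pselect (b = a %[mod p ^ m]); first by exists M.
    by exists 0%N => /ba.
  have [Mb HMb] := choice ch.
  (* There are finitely many residues modulo p^(m+1), so the largest of their depths works for the
     whole class. *)
  apply: bad_a; exists (maxn m.+1 (\max_(b < p ^ m.+1) Mb b)).
  move=> i j i' j' ij ij' ia ji i'i j'i.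
  have im : (i %% p ^ m.+1 < p ^ m.+1)%N by rewrite ltn_mod expn_gt0 prime_gt0.
  have le : (maxn m.+1 (Mb (i %% p ^ m.+1)) <=
             maxn m (maxn m.+1 (\max_(b < p ^ m.+1) Mb b)))%N.
    rewrite (leq_trans _ (leq_maxr _ _))// geq_max leq_maxl/=.
    rewrite (leq_trans _ (leq_maxr _ _))//.
    exact: (leq_bigmax (F := fun b : 'I_(p ^ m.+1) => Mb b) (Ordinal im)).
  apply: (HMb (i %% p ^ m.+1)%N); rewrite ?modn_mod//.
  - by rewrite modn_dvdm// dvdn_exp2l.
  - exact: eqmod_pX_le le ji.
  - exact: eqmod_pX_le le i'i.
  - exact: eqmod_pX_le le j'i.
have [g Hg] := choice step.
(* The descent starts from the class modulo 1, which contains all naturals. *)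
pose b := fix b m := if m is m'.+1 then g (m', b m') else 0%N.
have badb m : ~ good (b m) m.
  by elim: m => [//|m IH]; exact: (Hg (m, b m) IH).2.
have bS m : b m.+1 = b m %[mod p ^ m] by exact: (Hg (m, b m) (badb m)).1.
have bn m n : (m <= n)%N -> b n = b m %[mod p ^ m].
  move=> mn; rewrite -(subnKC mn); elim: (n - m)%N => [|k IH]; first by rewrite addn0.
  by rewrite addnS -IH; apply: eqmod_pX_le (bS _); exact: leq_addr.
have smallp (d : R) : 0 < d -> \forall m \near \oo, absv ((p ^ m)%:R : C) < d.
  move=> d0; apply: filterS (cvg_absv_lt0 _ _ _ (cvg_natXp (C := C) p_prime) d0) => m.
  by rewrite subr0.
have cb : cvgn (fun m => (b m)%:R : C).
  apply: cvgn_ultrametric => d d0; apply: filterS (smallp d d0) => m.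
  by apply: le_lt_trans; exact: absv_nat_eqmod.
set a : C := limn (fun m => (b m)%:R : C) in cb.
have ab m : absv (a - (b m)%:R) <= absv ((p ^ m)%:R : C).
  have p0 : 0 < absv ((p ^ m)%:R : C) by rewrite absv_gt0 pX_neq0.
  have [N _ HN] := cvg_absv_lt0 _ _ _ cb p0.
  apply: (absvB_trans_le (b (maxn N m))%:R).
    by rewrite absvBC ltW// HN//= leq_maxl.
  by apply: absv_nat_eqmod; apply: bn; exact: leq_maxr.
have Za : Defs.Zp C a.
  split.
    apply: (closed_cvg _ (@closed_closure _ _) _ _ cb).
    by apply: nearW => m; exact: (natr_in_Zp (C := C) (b m)).1.
  rewrite -(subrK (b 0%N)%:R a) absvD_le ?absv_nat_le1//.
  by rewrite (le_trans (ab 0%N))// absv_nat_le1.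
have [d d0 Hd] := UD_near _ _ _ UDf Za e0.
have [m _ Hm] := smallp d d0; have {}Hm := Hm m (leqnn m).
have near_a i : i = b m %[mod p ^ m] -> absv (a - i%:R) < d.
  move=> ib; apply: (le_lt_trans _ Hm).
  by apply: (absvB_trans_le (b m)%:R) => //; exact: absv_nat_eqmod.
have dq_lt i j : i != j -> i = b m %[mod p ^ m] -> j = b m %[mod p ^ m] ->
    absv (nat_dq f i j - padic_deriv f a) < e.
  move=> ij ib jb; apply: Hd; [exact: natr_in_Zp | exact: natr_in_Zp | | exact: near_a | exact: near_a].
  apply: contra_neq ij => /eqP; rewrite -subr_eq0 => h.
  have [le|/ltnW le] := leqP j i; move: h.
    by rewrite -natrB// padic_natr_eq0// => h; lia.
  by rewrite -oppr_eq0 opprB -natrB// padic_natr_eq0// => h; lia.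
(* All quotients from this class are within e of f'(a), which makes the class good at depth 0. *)
apply: (badb m); exists 0%N => i j i' j' ij ij' ib; rewrite maxn0 => ji i'i j'i.
apply: (absvB_trans_lt (padic_deriv f a)); first by rewrite dq_lt ?ji.
by rewrite absvBC dq_lt ?i'i ?j'i.
Qed.

(** The pairs (i + p^N, i) tend to (i, i) off the diagonal. *)
Lemma cvg_padic_deriv f i : UD f ->
  (fun N => (f (i + p ^ N)%:R - f i%:R) / (p ^ N)%:R) @ \oo
    --> padic_deriv f (i%:R : C).
Proof.
move=> UDf; apply/cvg_absvP => e e0.
have [d d0 Hd] := UD_near _ _ _ UDf (natr_in_Zp (C := C) i) e0.
near=> N.
have -> : (p ^ N)%:R = (i + p ^ N)%:R - i%:R :> C by rewrite natrD addrAC subrr add0r.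
apply: (Hd (i + p ^ N)%:R i%:R); [exact: natr_in_Zp | exact: natr_in_Zp | | | ].
- by rewrite -subr_eq0 natrD addrAC subrr add0r pX_neq0.
- rewrite natrD opprD addrA subrr; near: N.
  apply: filterS (cvg_absv_lt0 _ _ _ (cvg_natXp (C := C) p_prime) d0) => N.
  by rewrite subr0 add0r absvN.
- by rewrite subrr absv0.
Unshelve. all: by end_near. Qed.

End UniformlyDifferentiable.

(** * Convergence of the q-sums and their behaviour under translation *)

Lemma sum_nat_blocks (V : nmodType) m P (F : nat -> V) :
  \sum_(0 <= x < m * P) F x = \sum_(0 <= j < m) \sum_(0 <= x < P) F (j * P + x)%N.
Proof.
rewrite big_nat_mul; apply: eq_bigr => j _.
rewrite -{1}[(j * P)%N]add0n big_addn mulSn addnK.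
by apply: eq_bigr => x _; rewrite addnC.
Qed.

Section QIntegral.
Context {p : nat} {R : realType} {C : padicComplexType p R}.
Hypothesis p_prime : prime p.
Context {q : C}.
Hypotheses (q1 : absv (q - 1) < 1) (log_q : padic_log q != 0).
Implicit Types f : C -> C.

Let L0 N : log_quot q N != 0. Proof. exact: log_quot_neq0. Qed.

Let P0 N : (p ^ N)%:R != 0 :> C. Proof. exact: pX_neq0. Qed.

Lemma qX_subr1 N : q ^+ (p ^ N) - 1 = log_quot q N * (p ^ N)%:R.
Proof. by rewrite /log_quot divfK. Qed.

Lemma absv_qX_le1 n : absv (q ^+ n) <= 1.
Proof.
rewrite absvX exprn_ile1 ?absv_ge0// -(subrK 1 q).
by rewrite absvD_le ?absv1// ltW.
Qed.

Lemma q_neq0 : q != 0.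
Proof.
apply: contraTneq q1 => ->; by rewrite sub0r absvN absv1 ltxx.
Qed.

(** This isolates 1/p^N, the only factor that is unbounded as N grows. *)
Lemma qnum_inv N : (qnum q (p ^ N))^-1 = (q - 1) / log_quot q N / (p ^ N)%:R.
Proof.
rewrite /qnum -(opprB _ 1) qX_subr1 -(opprB q) invrN mulrNN.
by rewrite invfM invrK mulrC invfM mulrA.
Qed.

Lemma qnum_neq0 N : qnum q (p ^ N) != 0.
Proof.
rewrite -invr_eq0 qnum_inv !mulf_neq0 ?invr_eq0//.
apply: contra_neq (L0 0%N) => /eqP; rewrite subr_eq0 => /eqP q_1.
by rewrite /log_quot q_1 expr1n subrr mul0r.
Qed.

Lemma cvg_qX : (fun N => q ^+ (p ^ N)) @ \oo --> (1 : C).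
Proof.
have -> : (fun N => q ^+ (p ^ N)) = (fun N => log_quot q N * (p ^ N)%:R + 1).
  by apply/funext => N; rewrite -qX_subr1 subrK.
rewrite -[X in _ --> X]add0r -[X in _ --> X + _](mulr0 (padic_log q)).
apply: cvgD_absv (cvg_cst _); apply: cvgM_absv; last exact: cvg_natXp.
exact: cvg_log_quot.
Qed.

Lemma qnum_pXS N :
  qnum q (p ^ N.+1) = qnum q (p ^ N) * \sum_(0 <= j < p) (q ^+ (p ^ N)) ^+ j.
Proof.
rewrite /qnum expnSr exprM mulrAC; congr (_ / _).
rewrite -opprB subrX1 -(big_mkord xpredT (fun j => (q ^+ (p ^ N)) ^+ j)).
by rewrite -mulNr opprB.
Qed.

(** As [p^(N+1)]_q is [p^N]_q times the sum of the Q^j, the N-th sum can be spread over the p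
    translates with weights Q^j, leaving only differences of f. *)
Lemma q_sumS_sub f N :
  q_sum q f N.+1 - q_sum q f N = (qnum q (p ^ N.+1))^-1 *
    \sum_(0 <= j < p) \sum_(0 <= x < p ^ N)
      (f (j * p ^ N + x)%:R - f x%:R) * (q ^+ x * (q ^+ (p ^ N)) ^+ j).
Proof.
have := qnum_neq0 N.+1; rewrite qnum_pXS mulf_eq0 negb_or => /andP[qN sN].
rewrite /q_sum {2}expnS sum_nat_blocks qnum_pXS.
set s := \sum_(0 <= j < p) (q ^+ (p ^ N)) ^+ j in sN *.
set S := \sum_(0 <= x < p ^ N) f x%:R * q ^+ x.
have -> : (qnum q (p ^ N))^-1 * S = (qnum q (p ^ N) * s)^-1 * (s * S).
  by field; rewrite sN qN.
rewrite -mulrBr; congr (_ * _).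
rewrite big_distrl/= -sumrB; apply: eq_bigr => j _.
rewrite big_distrr/= -sumrB; apply: eq_bigr => x _.
by rewrite exprD mulnC exprM mulrBl; congr (_ - _); ring.
Qed.

(** For N >= M, blocks of length p^M form a geometric series, so the sum is a constant times q^(p^N)
    - 1. *)
Lemma cvg_sum_mod M (g : nat -> C) :
  (fun N => \sum_(0 <= x < p ^ N) q ^+ x * g (x %% p ^ M)%N) @ \oo --> (0 : C).
Proof.
set s := \sum_(0 <= r < p ^ M) q ^+ r * g r.
have QM : q ^+ (p ^ M) - 1 != 0 by rewrite qX_subr1 mulf_neq0.
have E N : (M <= N)%N -> \sum_(0 <= x < p ^ N) q ^+ x * g (x %% p ^ M)%N =
    (q ^+ (p ^ N) - 1) * (s / (q ^+ (p ^ M) - 1)).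
  move=> MN; rewrite -{1}(subnK MN) expnD sum_nat_blocks.
  rewrite (eq_bigr (fun j => (q ^+ (p ^ M)) ^+ j * s)); last first.
    move=> j _; rewrite big_distrr/=; apply: eq_big_nat => x /andP[_ xM].
    by rewrite modnMDl modn_small// exprD mulnC exprM mulrA.
  rewrite -big_distrl/= (big_mkord xpredT (fun j => (q ^+ (p ^ M)) ^+ j)).
  have -> : q ^+ (p ^ N) = (q ^+ (p ^ M)) ^+ (p ^ (N - M)).
    by rewrite -exprM -expnD subnKC.
  by rewrite subrX1; field.
have h : (fun N => (q ^+ (p ^ N) - 1) * (s / (q ^+ (p ^ M) - 1))) @ \oo --> (0 : C).
  rewrite -[X in _ --> X](mul0r (s / (q ^+ (p ^ M) - 1))).
  apply: cvgM_absv (cvg_cst _); rewrite -(subrr (1 : C)).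
  exact: cvgD_absv cvg_qX (cvg_cst _).
apply/cvg_absvP => e e0; near=> N; rewrite E; last by near: N; exact: nbhs_infty_ge.
by near: N; exact: cvg_absv_lt0.
Unshelve. all: by end_near. Qed.

Lemma q_integrable_UD f : UD f -> q_integrable q f.
Proof.
move=> UDf; apply: cvgn_ultrametric => e0 e00.
(* With P = p^N, [k] is the eventual value of |P| / |[pP]_q|. The [+ 1] in [e] makes k e < e0
   strict. *)
pose k := absv (q - 1) / absv (padic_log q) / absv (p%:R : C).
have k0 : 0 <= k by rewrite !divr_ge0 ?absv_ge0.
have k10 : 0 < k + 1 by rewrite ltr_wpDl.
pose e := e0 / (k + 1).
have e_gt0 : 0 < e by rewrite divr_gt0.
have [M HM] := UD_nat_uniform p_prime f e UDf e_gt0.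
(* One reference quotient per residue class modulo p^M, independent of N. *)
pose g r := diff_quot f ((r + p ^ M)%:R, r%:R).
near=> N.
have MN : (M <= N)%N by near: N; exact: nbhs_infty_ge.
have WN : absv (\sum_(0 <= x < p ^ N) q ^+ x * g (x %% p ^ M)%N) < e.
  by rewrite -[X in absv X]subr0; near: N; apply: cvg_absv_lt0 => //; exact: cvg_sum_mod.
have LN : absv (log_quot q N.+1) = absv (padic_log q).
  near: N; have := near_absv_eq _ _ (cvg_log_quot p_prime q q1) log_q.
  by case=> n _ Hn; exists n => // m /= nm; apply: Hn => /=; exact: leqW.
have term j x : absv ((f (j * p ^ N + x)%:R - f x%:R) * (q ^+ x * (q ^+ (p ^ N)) ^+ j)
    - (p ^ N)%:R * (j%:R * (q ^+ (p ^ N)) ^+ j * (q ^+ x * g (x %% p ^ M)%N)))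
    <= absv ((p ^ N)%:R : C) * e.
  (* For j = 0 the pair lies on the diagonal, outside the uniform estimate, but both terms
     vanish. *)
  have [->|j0] := posnP j.
    by rewrite mul0n add0n subrr !mul0r mulr0 subrr absv0 mulr_ge0 ?absv_ge0// ltW.
  have jP0 : (j * p ^ N)%:R != 0 :> C.
    by rewrite padic_natr_eq0// -lt0n muln_gt0 j0 expn_gt0 prime_gt0.
  have -> : f (j * p ^ N + x)%:R - f x%:R =
      (j * p ^ N)%:R * diff_quot f ((j * p ^ N + x)%:R, x%:R).
    by rewrite /diff_quot/= natrD addrK mulrC divfK.
  set D := diff_quot f _.
  have -> : (j * p ^ N)%:R * D * (q ^+ x * (q ^+ (p ^ N)) ^+ j)
    - (p ^ N)%:R * (j%:R * (q ^+ (p ^ N)) ^+ j * (q ^+ x * g (x %% p ^ M)%N)) =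
    (p ^ N)%:R * (j%:R * q ^+ x * (q ^+ (p ^ N)) ^+ j * (D - g (x %% p ^ M)%N)).
    by rewrite natrM; ring.
  rewrite absvM ler_wpM2l ?absv_ge0// absvM -[e]mul1r ler_pM ?absv_ge0//.
    rewrite -exprM !absvM mulr_ile1 ?mulr_ge0 ?absv_ge0 ?absv_qX_le1//.
    by rewrite mulr_ile1 ?absv_ge0 ?absv_qX_le1 ?absv_nat_le1.
  have pMN : (p ^ M %| j * p ^ N)%N by rewrite dvdn_mull// dvdn_exp2l.
  have xjN : x = (j * p ^ N + x)%N %[mod p ^ M].
    by case/dvdnP: pMN => c ->; rewrite modnMDl.
  have pM0 : (0 < p ^ M)%N by rewrite expn_gt0 prime_gt0.
  apply/ltW/HM.
  - by rewrite -[X in _ != X]add0n eqn_add2r -lt0n muln_gt0 j0 expn_gt0 prime_gt0.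
  - by rewrite -[X in _ != X]addn0 eqn_add2l -lt0n.
  - by [].
  - by rewrite modnDr modn_mod.
  - by rewrite modn_mod.
rewrite q_sumS_sub.
set S := \sum_(0 <= j < p) _.
set W := \sum_(0 <= x < p ^ N) _ in WN.
(* Replacing quotients by g turns S into P times an integral combination of powers of Q, times W;
   since |W| < e, also |S| <= |P| e. *)
have SW : absv (S - (p ^ N)%:R * (\sum_(0 <= j < p) j%:R * (q ^+ (p ^ N)) ^+ j * W))
    <= absv ((p ^ N)%:R : C) * e.
  rewrite big_distrr/= -sumrB; apply: absv_sum_le.
    by rewrite mulr_ge0 ?absv_ge0// ltW.
  move=> j _; rewrite !big_distrr/= -sumrB; apply: absv_sum_le => //.
  by rewrite mulr_ge0 ?absv_ge0// ltW.
have Se : absv S <= absv ((p ^ N)%:R : C) * e.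
  rewrite -[S](subrK ((p ^ N)%:R * (\sum_(0 <= j < p) j%:R * (q ^+ (p ^ N)) ^+ j * W))).
  apply: absvD_le => //; rewrite absvM ler_wpM2l ?absv_ge0//.
  apply: absv_sum_le => [|j _]; first exact: ltW.
  rewrite absvM (le_trans _ (ltW WN))// ler_piMl ?absv_ge0// -exprM absvM.
  by rewrite mulr_ile1 ?absv_ge0 ?absv_qX_le1 ?absv_nat_le1.
rewrite absvM qnum_inv !absvM !absvV LN.
have -> : absv ((p ^ N.+1)%:R : C) = absv (p%:R : C) * absv ((p ^ N)%:R : C).
  by rewrite expnS natrM absvM.
have a0 : absv ((p ^ N)%:R : C) != 0 by rewrite gt_eqF// absv_gt0.
have c0 : absv (p%:R : C) != 0.
  by rewrite gt_eqF// absv_gt0 padic_natr_eq0// -lt0n prime_gt0.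
apply: (@le_lt_trans _ _ (k * e)).
  rewrite invfM mulrA -/k -mulrA ler_wpM2l// mulrC ler_pdivrMr ?lt_neqAle 1?eq_sym ?a0 ?absv_ge0//.
  by rewrite mulrC.
by rewrite mulrA ltr_pdivrMr// mulrC ltr_pM2l// ltrDl.
Unshelve. all: by end_near. Qed.

(** The factor q^n turns q^x into q^(x + n). Cutting [0, n + P) once at P and once at n then
    compares the sums over [n, n + P) and [0, P). *)
Lemma q_sum_shift f n N :
  q ^+ n * q_sum q (fun x => f (x + n%:R)) N = q_sum q f N +
    \sum_(0 <= i < n) (qnum q (p ^ N))^-1 *
       (f (i + p ^ N)%:R * q ^+ (i + p ^ N) - f i%:R * q ^+ i).
Proof.
rewrite -big_distrr/= /q_sum mulrCA -mulrDr; congr (_ * _).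
pose F i := f i%:R * q ^+ i.
rewrite sumrB big_distrr/=.
rewrite (eq_bigr (fun x => F (x + n)%N)); last first.
  by move=> x _; rewrite /F natrD exprD; ring.
rewrite addrC -addrAC; apply/esym/eqP; rewrite subr_eq addrC; apply/eqP.
have cat a b : \sum_(0 <= x < a) F x + \sum_(0 <= x < b) F (x + a)%N =
    \sum_(0 <= x < a + b) F x.
  rewrite [RHS](big_cat_nat (n := a)) ?leq_addr//=; congr (_ + _).
  by rewrite -{2}[a]add0n big_addn addKn.
by rewrite (cat (p ^ N)%N n) addrC (cat n (p ^ N)%N) addnC.
Qed.

Lemma cvg_boundary f i : UD f ->
  (fun N => (qnum q (p ^ N))^-1 *
     (f (i + p ^ N)%:R * q ^+ (i + p ^ N) - f i%:R * q ^+ i)) @ \oo -->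
  (q - 1) / padic_log q *
    (padic_deriv f i%:R * q ^+ i + padic_log q * (f i%:R * q ^+ i)).
Proof.
move=> UDf.
(* Here f(i + P) Q - f(i) = (f(i + P) - f(i)) Q + f(i) (Q - 1), where Q - 1 is P times [log_quot],
   so 1/P is absorbed in both terms. *)
have -> : (fun N => (qnum q (p ^ N))^-1 *
     (f (i + p ^ N)%:R * q ^+ (i + p ^ N) - f i%:R * q ^+ i)) =
   (fun N => (q - 1) / log_quot q N *
     ((f (i + p ^ N)%:R - f i%:R) / (p ^ N)%:R * (q ^+ i * q ^+ (p ^ N)) +
       log_quot q N * (f i%:R * q ^+ i))).
  apply/funext => N; rewrite qnum_inv exprD.
  rewrite -[q ^+ (p ^ N)](subrK 1) qX_subr1.
  by field; rewrite P0 L0.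
have cL := cvg_log_quot p_prime q q1.
apply: cvgM_absv; first by apply: cvgM_absv (cvg_cst _) _; exact: cvgV_absv.
apply: cvgD_absv; last exact: cvgM_absv cL (cvg_cst _).
apply: cvgM_absv; first exact: cvg_padic_deriv.
rewrite -[X in _ --> X]mulr1; apply: cvgM_absv (cvg_cst _) cvg_qX.
Qed.

End QIntegral.

(** * The translation formula for the q-integral *)

Theorem theorem1 (p : nat) (R : realType) (C : padicComplexType p R)
    (q : C) (f : C -> C) (n : nat) :
  prime p -> odd p ->
  absv (q - 1) < 1 -> padic_log q != 0 ->
  UD f -> (1 <= n)%N ->
  let fn := fun x => f (x + n%:R) in
  [/\ q_integrable q fn, q_integrable q f &
    q ^+ n * q_integral q fn - q_integral q f =
      (q - 1) / padic_log q *
        (\sum_(0 <= i < n) padic_deriv f i%:R * q ^+ i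
         + padic_log q * \sum_(0 <= i < n) f i%:R * q ^+ i)].
Proof.
move=> p_prime _ q1 log_q UDf _ fn.
have If : q_integrable q f by exact: q_integrable_UD.
have qn0 : q ^+ n != 0 by rewrite expf_neq0// q_neq0.
have cB := cvg_sum_absv n _ _ (fun i => cvg_boundary p_prime q1 log_q f i UDf).
have cqfn := cvgD_absv _ _ _ _ If cB.
(* Dividing the shifted sums by q^n yields both the integrability of [fn] and the value of its
   integral. *)
have cfn : q_sum q fn @ \oo --> (q ^+ n)^-1 * (q_integral q f + \sum_(0 <= i < n)
    (q - 1) / padic_log q *
      (padic_deriv f i%:R * q ^+ i + padic_log q * (f i%:R * q ^+ i))).
  have -> : q_sum q fn = (fun N => (q ^+ n)^-1 * (q ^+ n * q_sum q fn N)).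
    by apply/funext => N; rewrite mulKf.
  under eq_cvg do rewrite q_sum_shift.
  exact: cvgM_absv (cvg_cst _) cqfn.
split=> //; first by apply/cvg_ex; eexists; exact: cfn.
rewrite {1}/q_integral (cvg_lim hausdorff_ultrametric cfn) mulVKf// addrAC subrr add0r.
by rewrite -big_distrr/= big_split/= -big_distrr.
Qed.
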